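(* Let $\mathcal{G}$ be a finite game, let $x^*\in\mathcal{X}$, and let $x(t)=Q(y(t))$ where $y(t)$ solves $\dot y_k=v_k(Q(y))$, $k\in\mathcal{N}$. (I) If $x^*$ is stationary, then it is a Nash equilibrium of $\mathcal{G}$; conversely, if $x^*$ is a Nash equilibrium of $\mathcal{G}$ and $x^*\in\operatorname{im}Q$, then $x^*$ is stationary. (II) If $\lim_{t\to\infty}x(t)=x^*$, then $x^*$ is a Nash equilibrium of $\mathcal{G}$. (III) If $x^*$ is Lyapunov stable, then $x^*$ is a Nash equilibrium of $\mathcal{G}$. (IV) If $x^*$ is a strict Nash equilibrium of $\mathcal{G}$, then it is asymptotically stable.
   Context: Setting: finite game $\mathcal{G}$ with players $\mathcal{N}$, action sets $\mathcal{A}_k$, mixed strategies $\mathcal{X}_k=\Delta(\mathcal{A}_k)$, $\mathcal{X}=\prod_k\mathcal{X}_k$, multilinear expected payoffs $u_k$, payoff vectors $v_k(x)=(u_k(\alpha;x_{-k}))_{\alpha\in\mathcal{A}_k}$. Each player has a penalty function $h_k$ on $\mathcal{X}_k$ (continuous, $C^\infty$ on relative interiors of faces, strongly convex: $h(tx_1+(1-t)x_2)\le th(x_1)+(1-t)h(x_2)-\tfrac12Kt(1-t)\|x_1-x_2\|^2$, $K>0$), with choice map $Q_k(y_k)=\arg\max_{x_k\in\mathcal{X}_k}\{\langle y_k,x_k\rangle-h_k(x_k)\}$; $Q=(Q_k)_k$. Orbits are $x(t)=Q(y(t))$ for solutions $y(t)$ of the dynamics. $x^*$ is: stationary if $x^*\in\operatorname{im}Q$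 and every orbit with $x(0)=x^*$ satisfies $x(t)=x^*$ for all $t\ge0$; Lyapunov stable if for every neighborhood $U$ of $x^*$ in $\mathcal{X}$ there is a neighborhood $V$ such that every orbit with $x(0)\in V\cap\operatorname{im}Q$ stays in $U$ for all $t\ge0$; attracting if it has a neighborhood $V$ such that every orbit with $x(0)\in V\cap\operatorname{im}Q$ converges to $x^*$; asymptotically stable if Lyapunov stable and attracting. $x^*$ is a Nash equilibrium if $u_k(x^* )\ge u_k(x_k;x^*_{-k})$ for all $x_k\in\mathcal{X}_k$, $k\in\mathcal{N}$; strict if the inequality is strict for all $x_k\ne x_k^*$. *)

(* Defs.v *)
From HB Require Import structures.
From mathcomp Require Import all_boot all_order all_algebra.
From mathcomp Require Import all_classical all_reals all_analysis.
Unset Printing Implicit Defensive.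
Import Order.TTheory GRing.Theory Num.Theory.
Import numFieldNormedType.Exports.
Local Open Scope classical_set_scope.
Local Open Scope ring_scope.

Section Game.
Context {R : realType} {N : finType} {A : N -> finType}.

Definition pprofile := {dffun forall k, A k}.
Definition mprofile := forall k, A k -> R.

Definition simplex {k : N} : set (A k -> R) :=
  [set z | (forall a, 0 <= z a) /\ \sum_(a : A k) z a = 1].

Definition strategy_space : set mprofile :=
  [set x | forall k, simplex (x k)].

Definition exp_payoff (U : N -> pprofile -> R) (k : N) (x : mprofile) : R :=
  \sum_(p : pprofile) U k p * \prod_(j : N) x j (p j).

Definition deviate (x : mprofile) (k : N) (z : A k -> R) : mprofile :=
  fun j => match k =P j with
           | ReflectT e => eq_rect k (fun i => A i -> R) z j e
           | ReflectF _ => x j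
           end.

Definition pure {k : N} (a : A k) : A k -> R := fun b => (b == a)%:R.

Definition payvec (U : N -> pprofile -> R) (k : N) (x : mprofile) : A k -> R :=
  fun a => exp_payoff U k (deviate x k (pure a)).

Definition nash (U : N -> pprofile -> R) (x : mprofile) : Prop :=
  forall k (z : A k -> R), simplex z ->
    exp_payoff U k (deviate x k z) <= exp_payoff U k x.

Definition strict_nash (U : N -> pprofile -> R) (x : mprofile) : Prop :=
  forall k (z : A k -> R), simplex z -> z <> x k ->
    exp_payoff U k (deviate x k z) < exp_payoff U k x.

Definition sqnorm {k : N} (z : A k -> R) : R := \sum_(a : A k) z a ^+ 2.
Definition dist1 {k : N} (z w : A k -> R) : R := \sum_(a : A k) `|z a - w a|.

Definition rel_continuous {k : N} (S : set (A k -> R)) (f : (A k -> R) -> R) :=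
  forall z, S z -> forall e : R, 0 < e -> exists2 d : R, 0 < d &
    forall w, S w -> dist1 z w < d -> `|f w - f z| < e.

Definition relint_face {k : N} (S : {set A k}) : set (A k -> R) :=
  [set z | simplex z /\ forall a, (0 < z a) <-> (a \in S)].

Definition tangent {k : N} (S : {set A k}) (d : A k -> R) : Prop :=
  (forall a, a \notin S -> d a = 0) /\ \sum_(a : A k) d a = 0.

Definition dderiv {k : N} (f : (A k -> R) -> R) (d : A k -> R) : (A k -> R) -> R :=
  fun z => derive1 (fun s : R => f (fun a => z a + s * d a)) 0.

Definition iter_dderiv {k : N} (f : (A k -> R) -> R) (ds : seq (A k -> R)) :=
  foldr (fun d g => dderiv g d) f ds.

Definition smooth_on_face {k : N} (S : {set A k}) (f : (A k -> R) -> R) :=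
  forall ds : seq (A k -> R), (forall d, d \in ds -> tangent S d) ->
    (forall d z, tangent S d -> relint_face S z ->
       derivable (fun s : R => iter_dderiv f ds (fun a => z a + s * d a)) 0 1)
    /\ rel_continuous (relint_face S) (iter_dderiv f ds).

Definition strongly_convex {k : N} (f : (A k -> R) -> R) :=
  exists2 K : R, 0 < K &
    forall z1 z2, simplex z1 -> simplex z2 -> forall t : R, 0 <= t <= 1 ->
      f (fun a => t * z1 a + (1 - t) * z2 a)
      <= t * f z1 + (1 - t) * f z2
         - 2^-1 * K * t * (1 - t) * sqnorm (fun a => z1 a - z2 a).

Definition penalty {k : N} (f : (A k -> R) -> R) : Prop :=
  [/\ rel_continuous (@simplex k) f,
      (forall S : {set A k}, S != finset.set0 -> smooth_on_face S f)
    & strongly_convex f].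

Definition is_choice {k : N} (h : (A k -> R) -> R) (w z : A k -> R) : Prop :=
  simplex z /\ forall z', simplex z' ->
    \sum_(a : A k) w a * z' a - h z' <= \sum_(a : A k) w a * z a - h z.

Definition choice_map {k : N} (h : (A k -> R) -> R) (w : A k -> R) : A k -> R :=
  xget (fun _ => 0) [set z | is_choice h w z].

Definition Qmap (h : forall k, (A k -> R) -> R) (y : mprofile) : mprofile :=
  fun k => choice_map (h k) (y k).

Definition is_solution (U : N -> pprofile -> R) (h : forall k, (A k -> R) -> R)
    (y : R -> mprofile) : Prop :=
  (forall k a (t : R), 0 < t ->
     is_derive t 1 (fun s : R => (y s) k a) (payvec U k (Qmap h (y t)) a))
  /\ (forall k a, (fun s => y s k a) @ 0^'+ --> y 0 k a).

Definition dist (x x' : mprofile) : R := \sum_(k : N) dist1 (x k) (x' k).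

Definition image_Q (h : forall k, (A k -> R) -> R) : set mprofile :=
  range (Qmap h).

Definition stationary U h (xs : mprofile) : Prop :=
  image_Q h xs /\
  forall y, is_solution U h y -> Qmap h (y 0) = xs ->
    forall t : R, 0 <= t -> Qmap h (y t) = xs.

Definition orbit_converges h (y : R -> mprofile) (xs : mprofile) : Prop :=
  forall k a, Qmap h (y t) k a @[t --> +oo] --> xs k a.

(** neighborhoods of xs in X are taken w.r.t. dist (all norms equivalent) *)
Definition lyapunov_stable U h (xs : mprofile) : Prop :=
  forall e : R, 0 < e -> exists2 d : R, 0 < d &
    forall y, is_solution U h y ->
      strategy_space (Qmap h (y 0)) -> image_Q h (Qmap h (y 0)) ->
      dist (Qmap h (y 0)) xs < d ->
      forall t : R, 0 <= t -> dist (Qmap h (y t)) xs < e.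

Definition attracting U h (xs : mprofile) : Prop :=
  exists2 d : R, 0 < d &
    forall y, is_solution U h y ->
      strategy_space (Qmap h (y 0)) -> image_Q h (Qmap h (y 0)) ->
      dist (Qmap h (y 0)) xs < d -> orbit_converges h y xs.

Definition asymptotically_stable U h xs : Prop :=
  lyapunov_stable U h xs /\ attracting U h xs.

End Game.

(* Main.v *)
(** Along a solution the score difference [y b - y a] of two actions of a player has
    derivative [v_b(x) - v_a(x)], and the choice [z] for scores [w] satisfies
    [z a * (w b - w a) <= 2 sup |h|].  Hence if [b] pays strictly more than a
    supported action [a] at [xs], an orbit that stays near [xs] loses the weight of
    [a], which is absurd; (I), (II) and (III) provide such orbits, by existence of
    solutions (Picard iteration, the choice map being Lipschitz by strong convexity)
    and density of the image of [Q].  Conversely, at a Nash equilibrium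
    [t |-> y 0 + t v(xs)] is a solution with constant orbit [xs], and solutions are
    unique.  A strict equilibrium is a vertex; near it all score differences to the
    equilibrium action decrease at a uniform rate, and the Fenchel coupling to a
    vertex is monotone in these differences, so the orbit is trapped and converges. *)

Require Import Defs.
From HB Require Import structures.
From mathcomp Require Import all_boot all_order all_algebra.
From mathcomp Require Import all_classical all_reals all_analysis.
From mathcomp Require Import ring lra.
Import Order.TTheory GRing.Theory Num.Theory.
Import numFieldNormedType.Exports.
Local Open Scope classical_set_scope.
Local Open Scope ring_scope.

Set Implicit Arguments.
Unset Strict Implicit.

(** * Calculus on the real line *)

Lemma continuous_antiderivative {R : realType} (g : R -> R) : continuous g ->
  exists2 G : R -> R, G 0 = 0 & forall t : R, 0 <= t -> is_derive t 1 G (g t).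
Proof.
move=> gC; set mu := @lebesgue_measure R.
(* Integrating from [-1] rather than [0] makes [t = 0] an interior point, so the derivative there is
   two-sided. *)
pose I (x : R) : R := (\int[mu]_(t in `[(- 1)%R, x]) g t)%R.
have dI t : 0 <= t -> derivable I t 1 /\ derive1 I t = g t.
  move=> t0; apply: (@continuous_FTC1 R g (BLeft (-1)) t (t + 1)).
  - by rewrite ltrDl.
  - apply: continuous_compact_integrable; first exact: segment_compact.
    exact: continuous_subspaceT.
  - by rewrite lte_fin; apply: lt_le_trans t0; rewrite oppr_lt0.
  - exact: gC.
exists (fun x => I x - I 0); first by rewrite subrr.
move=> t /dI[dIt DIt].
have -> : g t = g t - 0 by rewrite subr0.
apply: (@is_deriveB _ _ _ I (cst (I 0))).
by rewrite -DIt derive1E; exact: derivableP.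
Qed.

Lemma is_derive_continuous {R : realType} (F : R -> R) (t d : R) :
  is_derive t 1 F d -> {for t, continuous F}.
Proof.
move=> [dF _]; apply: differentiable_continuous; exact/derivable1_diffP.
Qed.

(** Mean value theorem. Right continuity at [a] is enough, and it is all that a solution provides at
    time [0]. *)
Lemma derive_le0_le {R : realType} (F d : R -> R) (a b : R) : a <= b ->
  (forall t, a < t <= b -> is_derive t 1 F (d t)) -> F @ a^'+ --> F a ->
  (forall t, a < t < b -> d t <= 0) -> F b <= F a.
Proof.
rewrite le_eqVlt => /predU1P[-> //|ab] dF Fa d0.
have cF t : a < t <= b -> {for t, continuous F}.
  by move=> /dF; exact: is_derive_continuous.
have [||c] := @MVT R F d a b ab.
- by move=> x /itvP xab; apply: dF; rewrite !xab.
- apply/(continuous_within_itvP _ ab); split => //.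
  + by move=> x; rewrite in_itv/= => /andP[ax xb]; apply: cF; rewrite ax ltW.
  + apply: cvg_at_left_filter; apply: cF; by rewrite ab lexx.
rewrite in_itv/= => /d0 dc0 /eqP; rewrite subr_eq => /eqP ->.
by rewrite gerDr mulr_le0_ge0 // subr_ge0 ltW.
Qed.

Lemma derive_norm_le {R : realType} (F d G g : R -> R) (a b : R) : a <= b ->
  (forall t, a < t <= b -> is_derive t 1 F (d t)) -> F @ a^'+ --> F a ->
  (forall t, a < t <= b -> is_derive t 1 G (g t)) -> G @ a^'+ --> G a ->
  (forall t, a < t < b -> `|d t| <= g t) -> `|F b - F a| <= G b - G a.
Proof.
move=> ab dF Fa dG Ga dg; rewrite ler_norml; apply/andP; split.
- have := @derive_le0_le R (- F - G) (fun t => - d t - g t) a b ab.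
  rewrite !fctE => H.
  suff : - F b - G b <= - F a - G a by move=> ?; lra.
  apply: H => [t tab||t tab].
  + by apply: is_deriveB; [apply: is_deriveN; exact: dF|exact: dG].
  + by apply: cvgB => //; exact: cvgN.
  + by have := dg _ tab; rewrite ler_norml => /andP[? ?]; lra.
- have := @derive_le0_le R (F - G) (fun t => d t - g t) a b ab.
  rewrite !fctE => H.
  suff : F b - G b <= F a - G a by move=> ?; lra.
  apply: H => [t tab||t tab].
  + by apply: is_deriveB; [exact: dF|exact: dG].
  + exact: cvgB.
  + by have := dg _ tab; rewrite ler_norml => /andP[? ?]; lra.
Qed.

Lemma is_derive_mull {R : realType} (c t : R) : is_derive t 1 (fun s : R => c * s) c.
Proof.
have := @is_deriveZ R _ _ (@id R) c t 1 1 (@is_derive_id _ _ t 1).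
by rewrite /GRing.scale/= mulr1.
Qed.

Lemma is_derive_expR_scale {R : realType} (c l t : R) :
  is_derive t 1 (fun s : R => c * expR (l * s)) (c * l * expR (l * t)).
Proof.
have -> : c * l * expR (l * t) = c * (expR (l * t) * l) by rewrite mulrAC mulrA.
exact: (@is_deriveZ R _ _ _ c t 1 _ (is_derive1_comp (is_derive_expR (l * t))
  (is_derive_mull l t))).
Qed.

(** The weight [expR (l * t)] reproduces itself under integration, with a gain of [1 / l]. When the
    field has Lipschitz constant [l / 2], this gives a contraction by [1 / 2] on the whole half-line
    at once. *)
Lemma expR_weighted_bound {R : realType} (F d : R -> R) (c l : R) : 0 <= c -> 0 < l ->
  F 0 = 0 -> F @ (0:R)^'+ --> F 0 -> (forall t : R, 0 < t -> is_derive t 1 F (d t)) ->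
  (forall t : R, 0 < t -> `|d t| <= c * l * expR (l * t)) ->
  forall t : R, 0 <= t -> `|F t| <= c * expR (l * t).
Proof.
move=> c0 l0 F0 cF dF bd t t0.
have dE (s : R) := is_derive_expR_scale c l s.
have := @derive_norm_le R F d (fun s => c * expR (l * s))
  (fun s => c * l * expR (l * s)) 0 t t0.
rewrite F0 subr0 mulr0 expR0 mulr1 => H.
apply: (@le_trans _ _ (c * expR (l * t) - c)); last by rewrite gerBl.
apply: H => [s /andP[s0 _]|||s /andP[s0 _]].
- exact: dF.
- by rewrite F0 in cF.
- apply: cvg_at_right_filter.
  have := is_derive_continuous (dE 0).
  by rewrite /prop_for /continuous_at mulr0 expR0 mulr1.
- exact: bd.
Qed.

(** The intervals of radius [r n = 2 * c / 2 ^+ n] around [u n] are nested, because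
    [r n - r n.+1 = c / 2 ^+ n]; the supremum of their left ends lies in all of them. *)
Lemma geometric_cauchy_limit {R : realType} (u : nat -> R) (c : R) :
  (forall n, `|u n.+1 - u n| <= c / 2 ^+ n) ->
  exists l, forall n, `|l - u n| <= 2 * c / 2 ^+ n.
Proof.
move=> uc; pose r n := 2 * c / 2 ^+ n.
have rS n : r n = r n.+1 + c / 2 ^+ n.
  rewrite /r exprS; have : (2 : R) ^+ n != 0 by rewrite expf_neq0.
  by move=> ?; field.
have c0 : 0 <= c.
  by have := uc 0%N; rewrite expr0 divr1; apply: le_trans.
have r0 n : 0 <= r n by rewrite /r divr_ge0 ?exprn_ge0 // mulr_ge0.
have lo m n : (m <= n)%N -> u m - r m <= u n - r n.
  elim: n => [|n IH]; first by rewrite leqn0 => /eqP ->.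
  rewrite leq_eqVlt => /predU1P[-> //|]; rewrite ltnS => /IH h.
  apply: le_trans h _; move: (uc n); rewrite ler_norml => /andP[? _].
  have := rS n => ?; lra.
have hi m n : (m <= n)%N -> u n + r n <= u m + r m.
  elim: n => [|n IH]; first by rewrite leqn0 => /eqP ->.
  rewrite leq_eqVlt => /predU1P[-> //|]; rewrite ltnS => /IH h.
  apply: le_trans _ h; move: (uc n); rewrite ler_norml => /andP[_ ?].
  have := rS n => ?; lra.
have lohi m n : u m - r m <= u n + r n.
  have [mn|/ltnW nm] := leqP m n.
    by apply: le_trans (lo _ _ mn) _; have := r0 n => ?; lra.
  by apply: le_trans _ (hi _ _ nm); have := r0 m => ?; lra.
pose E := range (fun n => u n - r n).
have hE : has_sup E.
  split; first by exists (u 0%N - r 0%N), 0%N.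
  by exists (u 0%N + r 0%N) => _ [m _ <-].
exists (sup E) => n; rewrite ler_norml; apply/andP; split.
- rewrite lerBrDr addrC; apply: sup_upper_bound => //; by exists n.
- rewrite lerBlDl; apply: ge_sup; first by exists (u 0%N - r 0%N), 0%N.
  by move=> _ [m _ <-].
Qed.

(** * Initial value problems *)

(** Lipschitz continuity for the sup norm, phrased with an arbitrary common bound [B] so that no
    maximum over [I] has to be formed. *)
Definition sup_lipschitz {R : realType} {I : finType} (l : R) (f : (I -> R) -> R) :=
  forall (u v : I -> R) (B : R),
    (forall j, `|u j - v j| <= B) -> `|f u - f v| <= l * B.

Lemma sup_lipschitz_cvg {R : realType} {I : finType} (l : R) (f : (I -> R) -> R)
    (T : Type) (F : set_system T) {FF : Filter F} (z : T -> I -> R) (u : I -> R) :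
  0 < l -> sup_lipschitz l f -> (forall j, z s j @[s --> F] --> u j) ->
  f (z s) @[s --> F] --> f u.
Proof.
move=> l0 fl zu; apply/cvgrPdist_lt => e e0.
have : \forall s \near F, forall j, `|u j - z s j| < e / (2 * l).
  apply: filter_forall => j; move/cvgrPdist_lt: (zu j); apply.
  by rewrite divr_gt0 // mulr_gt0.
apply: filterS => s H.
apply: (@le_lt_trans _ _ (l * (e / (2 * l)))).
  by apply: fl => j; exact/ltW/H.
have -> : l * (e / (2 * l)) = e / 2 by field; exact: lt0r_neq0.
by rewrite ltr_pdivrMr // ltr_pMr // ltr1n.
Qed.

Lemma exists_divX2_lt {R : realType} (K e : R) : 0 < e -> exists n, K / 2 ^+ n < e.
Proof.
move=> e0; exists (Num.trunc (K / e)).+1.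
rewrite ltr_pdivrMr ?exprn_gt0 // mulrC -ltr_pdivrMr //.
by apply: lt_trans (truncnS_gt _) _; rewrite -natrX ltr_nat ltn_expl.
Qed.

(* The Picard iterates [y n] satisfy
   |y n.+1 t - y n t| <= 2^-n * M * e^(2lt) with [M] independent of [t]:
   integrating [l * e^(2ls)] gains the factor 1/2. *)
Lemma picard_lindelof {R : realType} {I : finType} (f : (I -> R) -> I -> R) (l : R)
    (y0 : I -> R) : 0 < l -> (forall i, sup_lipschitz l (f ^~ i)) ->
  exists y : R -> I -> R, y 0 = y0 /\
    forall i (t : R), 0 <= t -> is_derive t 1 (y ^~ i) (f (y t) i).
Proof.
move=> l0 fl.
pose cont (z : R -> I -> R) := forall i t, 0 <= t -> {for t, continuous (z ^~ i)}.
pose step (z z' : R -> I -> R) :=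
  z' 0 = y0 /\ forall i (t : R), 0 <= t -> is_derive t 1 (z' ^~ i) (f (z t) i).
have step_cont z z' : step z z' -> cont z'.
  by move=> [_ dz'] i t t0; apply: is_derive_continuous (dz' i t t0).
(* Freezing time at [0] for negative arguments makes the integrands continuous on the whole line. *)
have pC : continuous (fun t : R => Num.max t 0).
  by move=> t; apply: continuous_max; [exact: cvg_id|exact: cvg_cst].
have cmax z i : cont z -> continuous (fun t : R => z (Num.max t 0) i).
  move=> cz t; apply: (@continuous_comp _ _ _ (fun s : R => Num.max s 0) (z ^~ i)).
    exact: pC.
  by apply: cz; rewrite le_max lexx orbT.
(* Continuity is a premise under the existential, so that [choice] yields one total operator [F];
   for discontinuous [z] the value [z] is an arbitrary default. *)
have ex_step z : exists z', cont z -> step z z'.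
  have [cz|] := pselect (cont z); last by move=> ncz; exists z.
  have gC i : continuous (fun t : R => f (z (Num.max t 0)) i).
    move=> t; apply: (@sup_lipschitz_cvg R I l (f ^~ i) _ _ _
      (fun s => z (Num.max s 0))) => // j; exact: cmax.
  have {gC} /choice[G GP] : forall i, exists G : R -> R, G 0 = 0 /\
      forall t : R, 0 <= t -> is_derive t 1 G (f (z (Num.max t 0)) i).
    by move=> i; have [G G0 GP] := continuous_antiderivative (gC i); exists G.
  exists (fun t i => y0 i + G i t) => _; split.
    by apply/funext => i; rewrite (GP i).1 addr0.
  move=> i t t0; have := (GP i).2 t t0; rewrite max_l // => dG.
  have -> : f (z t) i = 0 + f (z t) i by rewrite add0r.
  exact: (@is_deriveD _ _ _ (cst (y0 i)) (G i)).
have [F FP] := choice ex_step.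
pose z n := iter n F (fun=> y0).
have cz n : cont (z n).
  elim: n => [|n IH]; first by move=> i t _; exact: cst_continuous.
  exact: step_cont (FP _ IH).
have zP n : step (z n) (z n.+1) by exact: FP.
pose M := \sum_i `|f y0 i|.
have MP i : `|f y0 i| <= M.
  by rewrite /M (bigD1 i) //= lerDl sumr_ge0.
have M0 : 0 <= M by rewrite sumr_ge0.
(* The first increment has derivative [f y0], bounded by [M = c * (2 * l)], the form required by the
   weighted bound of rate [2 * l]. *)
pose c := M / (2 * l).
have c0 : 0 <= c by rewrite divr_ge0 // mulr_ge0 // ltW.
pose E (t : R) := expR (2 * l * t).
have cvg0 z1 z2 z1' z2' i : step z1 z1' -> step z2 z2' ->
    (fun t => z1' t i - z2' t i) @ (0:R)^'+ --> z1' 0 i - z2' 0 i.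
  move=> s1 s2; apply: cvgB; apply: cvg_at_right_filter.
  - exact: (step_cont _ _ s1 i 0 (lexx _)).
  - exact: (step_cont _ _ s2 i 0 (lexx _)).
have contr z1 z2 z1' z2' B : 0 <= B -> step z1 z1' -> step z2 z2' ->
    (forall (t : R) i, 0 <= t -> `|z1 t i - z2 t i| <= B * E t) ->
    forall (t : R) i, 0 <= t -> `|z1' t i - z2' t i| <= B / 2 * E t.
  move=> B0 s1 s2 H t i t0.
  apply: (@expR_weighted_bound R (fun s => z1' s i - z2' s i)
    (fun s => f (z1 s) i - f (z2 s) i) (B / 2) (2 * l)) => //.
  - by rewrite divr_ge0.
  - by rewrite mulr_gt0.
  - by rewrite s1.1 s2.1 subrr.
  - exact: cvg0 s1 s2.
  - move=> s /ltW s0; apply: (@is_deriveB _ _ _ (z1' ^~ i) (z2' ^~ i)).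
    + exact: s1.2.
    + exact: s2.2.
  - move=> s /ltW s0.
    have -> : B / 2 * (2 * l) * expR (2 * l * s) = l * (B * E s).
      by rewrite /E; field.
    by apply: fl => j; exact: H.
have zz n (t : R) i : 0 <= t -> `|z n.+1 t i - z n t i| <= c / 2 ^+ n * E t.
  elim: n t i => [|n IH] t i t0.
    rewrite expr0 divr1.
    apply: (@expR_weighted_bound R (fun s => z 1%N s i - z 0%N s i)
      (fun s => f y0 i) c (2 * l)) => //.
    - by rewrite mulr_gt0.
    - by rewrite (zP 0%N).1 subrr.
    - apply: cvgB; last exact: cvg_cst.
      apply: cvg_at_right_filter; exact: (cz 1%N i 0 (lexx _)).
    - move=> s /ltW s0; rewrite -[f y0 i]subr0.
      apply: (@is_deriveB _ _ _ (z 1%N ^~ i) (cst (y0 i))).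
      exact: (zP 0%N).2.
    - move=> s /ltW s0.
      have -> : c * (2 * l) = M by rewrite /c; field; exact: lt0r_neq0.
      apply: le_trans (MP i) _; rewrite ler_peMr // -expR0 ler_expR.
      by rewrite mulr_ge0 // mulr_ge0 // ltW.
  have -> : c / 2 ^+ n.+1 = c / 2 ^+ n / 2.
    by rewrite exprSr invfM mulrA mulrAC.
  by apply: contr (zP n.+1) (zP n) IH t i t0; rewrite divr_ge0 // exprn_ge0.
have lim (p : R * I) : exists w, forall n,
    `|w - z n (Num.max p.1 0) p.2| <= 2 * (c * E (Num.max p.1 0)) / 2 ^+ n.
  apply: geometric_cauchy_limit => n.
  by rewrite mulrAC; apply: zz; rewrite le_max lexx orbT.
have [w wP] := choice lim.
pose x (t : R) i := w (t, i).
have xz n (t : R) i : 0 <= t -> `|x t i - z n t i| <= 2 * c / 2 ^+ n * E t.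
  move=> t0; have := wP (t, i) n; rewrite /= max_l // => /le_trans; apply.
  by rewrite mulrA mulrAC.
(* An argument with three errors: [z n] approximates [x] uniformly for times up to [t + 1], and
   [z n] itself is continuous. *)
have cx : cont x.
  move=> i t t0; apply/cvgrPdist_lt => e e0.
  have e3 : 0 < e / 3 by rewrite divr_gt0.
  have [n nP] := exists_divX2_lt (2 * (c * E (t + 1))) e3.
  have bound (s : R) : Num.max s 0 <= t + 1 ->
      `|x s i - z n (Num.max s 0) i| < e / 3.
    move=> st; apply: le_lt_trans (wP (s, i) n) _; apply: le_lt_trans nP => /=.
    rewrite ler_wpM2r // ?invr_ge0 ?exprn_ge0 // ler_wpM2l // ler_wpM2l //.
    by rewrite ler_expR ler_wpM2l // mulr_ge0 // ltW.
  have H1 : \forall s \near t, `|z n (Num.max t 0) i - z n (Num.max s 0) i| < e / 3.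
    by move/cvgrPdist_lt: (cmax _ i (cz n) t); apply.
  have H2 : \forall s \near t, s <= t + 1.
    by apply: lt_le_nbhsl; rewrite ltrDl.
  near=> s.
  have b1 : `|x t i - z n (Num.max t 0) i| < e / 3.
    by apply: bound; rewrite max_l // lerDl.
  have b2 : `|x s i - z n (Num.max s 0) i| < e / 3.
    apply: bound; rewrite ge_max addr_ge0 // andbT; by near: s.
  have b3 : `|z n (Num.max t 0) i - z n (Num.max s 0) i| < e / 3 by near: s.
  move: b1 b2 b3; rewrite !ltr_norml => /andP[? ?] /andP[? ?] /andP[? ?].
  by apply/andP; split; lra.
have xy : step x (F x) by exact: FP.
exists (F x); split; first exact: xy.1.
move=> i t t0.
(* [F x] solves the equation driven by [x], so it remains to see that [x] is a fixed point: [z n.+1]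
   is within a multiple of [2^-n] of [x] as an approximant, and of [F x] by contraction. *)
suff -> : F x t = x t by exact: xy.2.
apply/funext => j; apply/eqP; rewrite -subr_eq0 -normr_le0.
apply/ler_addgt0Pl => e /(exists_divX2_lt (2 * c * E t))[n nP]; rewrite addr0.
apply: le_trans (ltW nP).
have h1 : `|z n.+1 t j - F x t j| <= 2 * c / 2 ^+ n / 2 * E t.
  apply: (contr _ _ _ _ _ _ (zP n) xy) => //.
    by apply: divr_ge0; [apply: mulr_ge0|apply: exprn_ge0].
  by move=> s k s0; rewrite distrC; exact: xz.
have h2 := xz n.+1 t j t0.
rewrite distrC -[x t j](subrK (z n.+1 t j)) -addrA.
apply: le_trans (ler_normD _ _) _; apply: le_trans (lerD h2 h1) _.
rewrite exprS; have : (2 : R) ^+ n != 0 by rewrite expf_neq0.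
by move=> ?; rewrite le_eqVlt; apply/orP; left; apply/eqP; field.
Unshelve. all: by end_near.
Qed.

(** * Choice maps on the simplex *)

Lemma cvg_sumr {R : realType} {I : finType} {T : Type} (F : set_system T)
    {FF : Filter F} (f : T -> I -> R) (l : I -> R) :
  (forall i, f t i @[t --> F] --> l i) -> \sum_i f t i @[t --> F] --> \sum_i l i.
Proof.
move=> fl; elim: (index_enum I) => [|i r IH].
  by rewrite big_nil; under eq_fun do rewrite big_nil; exact: cvg_cst.
by rewrite big_cons; under eq_fun do rewrite big_cons; exact: cvgD.
Qed.

Section Simplex.
Context {R : realType} {N : finType} {A : N -> finType} {k : N}.
Implicit Types (z w : A k -> R) (h : (A k -> R) -> R).

Lemma simplex_le1 z a : simplex z -> z a <= 1.
Proof. by move=> [z0 <-]; rewrite (bigD1 a) //= lerDl sumr_ge0. Qed.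

Lemma simplex_pure (a : A k) : simplex (pure a : A k -> R).
Proof.
split => [b|]; first by rewrite /pure ler0n.
rewrite (bigD1 a) //= /pure eqxx big1 ?addr0 // => b /negbTE; by rewrite eq_sym => ->.
Qed.

Lemma simplex_convex z w (t : R) : simplex z -> simplex w -> 0 <= t <= 1 ->
  simplex (fun a => t * z a + (1 - t) * w a).
Proof.
move=> [z0 z1] [w0 w1] /andP[t0 t1]; split.
  by move=> a; rewrite addr_ge0 // mulr_ge0 // subr_ge0.
by rewrite big_split /= -!mulr_sumr z1 w1; ring.
Qed.

Lemma simplex_inhabited z : simplex z -> exists a : A k, True.
Proof.
move=> [_ z1]; case: (pickP (predT : pred (A k))) => [a _|h0]; first by exists a.
by move: z1; rewrite big_pred0 // => /eqP; rewrite eq_sym oner_eq0.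
Qed.

(** * Compactness of the simplex and existence of minimisers *)

Section Compactness.
Import ArrowAsProduct.

Let coord_continuous (a : A k) : continuous (fun z : A k -> R => z a).
Proof. exact: (@proj_continuous (A k) (fun=> R : topologicalType) a). Qed.

(** In the product topology the simplex is a closed subset of a cube, which is compact by
    Tychonoff's theorem. *)
Lemma compact_simplex : compact (@simplex R N A k).
Proof.
have box : compact [set z : A k -> R | forall a, `[0, 1]%classic (z a)].
  apply: (@tychonoff (A k) (fun=> R : topologicalType) (fun=> `[0, 1]%classic)).
  by move=> a; exact: segment_compact.
apply: subclosed_compact box _; last first.
  move=> z zS a /=; rewrite in_itv/= simplex_le1 // andbT; exact: zS.1.
have -> : @simplex R N A k =
    (\bigcap_(a in setT) ((fun z : A k -> R => z a) @^-1` [set r | 0 <= r]))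
    `&` ((fun z : A k -> R => \sum_a z a) @^-1` [set 1]).
  apply/seteqP; split => z /=.
    by move=> [z0 z1]; split => // a _; exact: z0.
  by move=> [z0 z1]; split => // a; exact: z0.
apply: closedI.
  apply: closed_bigI => a _; apply: preimage_closed => [z _|].
    exact: coord_continuous.
  exact: closed_ge.
apply: preimage_closed => [z _|]; last exact: closed_eq.
exact: (@cvg_sumr R (A k) _ (nbhs z) _ (fun w a => w a) z (coord_continuous ^~ z)).
Qed.

(** Extreme value theorem. Since [dist1 z] is continuous in the product topology and vanishes at
    [z], the epsilon-delta form of continuity implies the topological one within the simplex. *)
Lemma simplex_min f : @simplex R N A k !=set0 -> rel_continuous (@simplex R N A k) f ->
  exists2 z, simplex z & forall w, simplex w -> f z <= f w.
Proof.
move=> s0 fC.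
have fc : {within (@simplex R N A k), continuous (f : (A k -> R) -> R)}.
  apply/subspace_continuousP => z zS; apply/cvgrPdist_lt => e e0.
  have [d d0 H] := fC z zS e e0.
  have cd : (fun w : A k -> R => dist1 z w) @ z --> 0.
    have -> : 0 = \sum_(a : A k) `|z a - z a|.
      by rewrite big1 // => a _; rewrite subrr normr0.
    apply: (@cvg_sumr R (A k) _ (nbhs z) _ (fun w a => `|z a - w a|)) => a.
    apply: cvg_norm; apply: cvgB; first exact: cvg_cst.
    exact: coord_continuous.
  have : \forall w \near z, dist1 z w < d.
    move/cvgrPdist_lt: cd => /(_ d d0); apply: filterS => w.
    by rewrite sub0r normrN; apply: le_lt_trans; exact: ler_norm.
  rewrite /within /=; apply: filterS => w wd wS.
  by rewrite distrC; exact: H.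
have [c cS cm] := compact_EVT_min s0 compact_simplex fc.
exists c; first exact: set_mem.
by move=> w wS; apply: cm; exact: mem_set.
Qed.
End Compactness.
End Simplex.

Section Choice.
Context {R : realType} {N : finType} {A : N -> finType} {k : N}.
Implicit Types (w z x : A k -> R).

Definition pairing w z : R := \sum_a w a * z a.

Lemma pairing_conv w z z' (t : R) :
  pairing w (fun a => t * z a + (1 - t) * z' a) = t * pairing w z + (1 - t) * pairing w z'.
Proof. by rewrite /pairing !mulr_sumr -big_split /=; apply: eq_bigr => a _; ring. Qed.

Lemma pairing_pure w (a : A k) : pairing w (pure a) = w a.
Proof.
rewrite /pairing (bigD1 a) //= /pure eqxx mulr1 big1 ?addr0 // => b /negbTE ->.
by rewrite mulr0.
Qed.

(** The weights [z b] sum to one. Relative to action [a], the pairing thus depends on [w] only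
    through score differences, which are what the dynamics control. *)
Lemma pairing_gap w z (a : A k) : simplex z ->
  pairing w z - w a = \sum_b z b * (w b - w a).
Proof.
move=> [_ z1]; rewrite -[w a in LHS]mul1r -{1}z1 mulr_suml /pairing -sumrB.
by apply: eq_bigr => b _; ring.
Qed.

Lemma sqr_le_sqnorm z (a : A k) : z a ^+ 2 <= sqnorm z.
Proof. by rewrite /sqnorm (bigD1 a) //= lerDl sumr_ge0 // => b _; exact: sqr_ge0. Qed.

Lemma dist1_ge z z' (a : A k) : `|z a - z' a| <= dist1 z z'.
Proof. by rewrite /dist1 (bigD1 a) //= lerDl sumr_ge0. Qed.

(** Brings [h] plus a linear or quadratic term within reach of [simplex_min]. *)
Lemma rel_continuousD_lipschitz (S : set (A k -> R)) (f g : (A k -> R) -> R) (C : R) :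
  rel_continuous S f ->
  (forall z z', S z -> S z' -> `|g z' - g z| <= C * dist1 z z') ->
  rel_continuous S (fun z => f z + g z).
Proof.
move=> fC gC z zS e e0; have e2 : 0 < e / 2 by rewrite divr_gt0.
have [d d0 H] := fC z zS _ e2.
have C1 : 0 < `|C| + 1 by rewrite ltr_wpDl.
exists (Num.min d (e / 2 / (`|C| + 1))); first by rewrite lt_min d0 divr_gt0.
move=> z' z'S; rewrite lt_min => /andP[zd ze].
have h1 := H _ z'S zd.
have h2 : `|g z' - g z| < e / 2.
  apply: le_lt_trans (gC _ _ zS z'S) _.
  apply: (@le_lt_trans _ _ ((`|C| + 1) * dist1 z z')).
    rewrite ler_wpM2r //; first by rewrite /dist1 sumr_ge0.
    by have := ler_norm C => ?; lra.
  by rewrite mulrC -ltr_pdivlMr.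
rewrite opprD addrACA; apply: le_lt_trans (ler_normD _ _) _; lra.
Qed.

Lemma rel_continuous_bounded (h : (A k -> R) -> R) : @simplex R N A k !=set0 ->
  rel_continuous (@simplex R N A k) h ->
  exists2 M : R, 0 < M & forall z, simplex z -> `|h z| <= M.
Proof.
move=> s0 hC; have [z1 _ m1] := simplex_min s0 hC.
have hNC : rel_continuous (@simplex R N A k) (fun z => - h z).
  by move=> z zS e /(hC z zS)[d d0 H]; exists d => // z' ? ?; rewrite -opprD normrN H.
have [z2 _ m2] := simplex_min s0 hNC.
exists (`|h z1| + `|h z2| + 1); first by rewrite ltr_wpDl ?addr_ge0.
move=> z zS; have := m1 _ zS; have := m2 _ zS; rewrite lerN2 => ? ?.
have := ler_norm (h z2); have := ler_norm (- h z1); rewrite normrN => ? ?.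
have := normr_ge0 (h z1); have := normr_ge0 (h z2) => ? ?.
by rewrite ler_norml; apply/andP; split; lra.
Qed.

Lemma choice_exists (h : (A k -> R) -> R) w : @simplex R N A k !=set0 ->
  rel_continuous (@simplex R N A k) h -> exists z, is_choice h w z.
Proof.
move=> s0 hC.
have [|z zS zm] := @simplex_min R N A k (fun z => h z + - pairing w z) s0.
  apply: (@rel_continuousD_lipschitz _ _ _ (\sum_a `|w a|) hC) => z z' _ _.
  rewrite -opprD normrN /pairing -sumrB; apply: le_trans (ler_norm_sum _ _ _) _.
  rewrite mulr_suml; apply: ler_sum => a _; rewrite -mulrBr normrM ler_wpM2l //.
  by rewrite distrC dist1_ge.
exists z; split => // z' /zm; rewrite -/(pairing w z) -/(pairing w z') => ?; lra.
Qed.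

Lemma choice_mapP (h : (A k -> R) -> R) w : @simplex R N A k !=set0 ->
  rel_continuous (@simplex R N A k) h -> is_choice h w (choice_map h w).
Proof. by move=> s0 hC; have := xgetPex (fun=> 0) (choice_exists w s0 hC). Qed.

(* Testing optimality at the midpoint of [z] and [z'] already yields a quadratic
   gap; the constant [K / 4] is not sharp. *)
Lemma choice_quadratic_gap (h : (A k -> R) -> R) (K : R) w z z' :
  (forall z1 z2, simplex z1 -> simplex z2 -> forall t : R, 0 <= t <= 1 ->
      h (fun a => t * z1 a + (1 - t) * z2 a)
      <= t * h z1 + (1 - t) * h z2
         - 2^-1 * K * t * (1 - t) * sqnorm (fun a => z1 a - z2 a)) ->
  is_choice h w z -> simplex z' ->
  pairing w z' - h z' + K / 4 * sqnorm (fun a => z a - z' a) <= pairing w z - h z.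
Proof.
move=> hK [zS zm] z'S.
have t01 : 0 <= (2^-1 : R) <= 1 by rewrite invr_ge0 ler0n invf_le1 // ler1n.
have := zm _ (simplex_convex zS z'S t01).
rewrite -/(pairing _ _) pairing_conv -/(pairing w z).
by have := hK _ _ zS z'S _ t01 => ? ?; lra.
Qed.

(** Each of two maximisers is at least as good as the other, which leaves no room for a positive
    quadratic gap. *)
Lemma choice_unique (h : (A k -> R) -> R) w z z' : strongly_convex h ->
  is_choice h w z -> is_choice h w z' -> z = z'.
Proof.
move=> [K K0 hK] zc z'c.
have := choice_quadratic_gap hK zc z'c.1.
have := z'c.2 _ zc.1; rewrite -/(pairing w z) -/(pairing w z') => h1 h2.
have s0 : K * sqnorm (fun a => z a - z' a) <= 0 by lra.
apply/funext => a; apply/eqP; rewrite -subr_eq0 -sqrf_eq0 eq_le sqr_ge0 andbT.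
apply: le_trans (sqr_le_sqnorm (fun a => z a - z' a) a) _.
by rewrite -(pmulr_rle0 _ K0).
Qed.

Lemma choice_map_eq (h : (A k -> R) -> R) w z : penalty h ->
  is_choice h w z -> choice_map h w = z.
Proof.
move=> [hC _ hK] zc; apply: (choice_unique hK _ zc).
apply: choice_mapP hC; by exists z; exact: zc.1.
Qed.

(** Adding the quadratic gaps of the two choices bounds [K / 2 * |z - z'|^2] by the pairing of
    [w - w'] with [z - z']; Young's inequality then absorbs half of the left side. *)
Lemma choice_lipschitz (h : (A k -> R) -> R) : penalty h -> @simplex R N A k !=set0 ->
  exists2 l : R, 0 < l & forall a, sup_lipschitz l (fun w => choice_map h w a).
Proof.
move=> [hC _ [K K0 hK]] s0; set n : R := #|A k|%:R + 1.
have n1 : 1 <= n by rewrite lerDr.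
have n0 : 0 < n by lra.
(* The estimate yields [2 * sqrt n / K]; as [1 <= n], the root may be replaced by [n]. *)
exists (2 * n / K); first by rewrite divr_gt0 // mulr_gt0.
move=> a w w' B wB.
have B0 : 0 <= B := le_trans (normr_ge0 _) (wB a).
have zc := choice_mapP w s0 hC; have zc' := choice_mapP w' s0 hC.
move: zc zc'; set z := choice_map h w; set z' := choice_map h w' => zc zc'.
have g1 := choice_quadratic_gap hK zc zc'.1.
have g2 := choice_quadratic_gap hK zc' zc.1.
have sqC : sqnorm (fun a => z' a - z a) = sqnorm (fun a => z a - z' a).
  by apply: eq_bigr => b _; ring.
set q := sqnorm (fun a => z a - z' a) in g1 sqC *; rewrite sqC in g2.
have g3 : pairing w z - pairing w z' + pairing w' z' - pairing w' z
    <= \sum_b B * `|z b - z' b|.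
  rewrite /pairing -!(sumrB, big_split) /=; apply: ler_sum => b _.
  have -> : w b * z b - w b * z' b + w' b * z' b - w' b * z b
     = (w b - w' b) * (z b - z' b) by ring.
  by apply: le_trans (ler_norm _) _; rewrite normrM ler_wpM2r.
(* [B s <= K/4 s^2 + B^2 / K] *)
have g4 : \sum_b B * `|z b - z' b| <= K / 4 * q + n * (B ^+ 2 / K).
  apply: (@le_trans _ _ (\sum_b (K / 4 * (z b - z' b) ^+ 2 + B ^+ 2 / K))).
    apply: ler_sum => b _; rewrite -[(z b - z' b) ^+ 2]real_normK ?num_real //.
    set s := `|z b - z' b|; rewrite -subr_ge0.
    have -> : K / 4 * s ^+ 2 + B ^+ 2 / K - B * s = (K * s / 2 - B) ^+ 2 / K.
      by field; exact: lt0r_neq0.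
    by rewrite divr_ge0 ?sqr_ge0 // ltW.
  rewrite big_split /= -mulr_sumr lerD2l sumr_const -mulr_natl ler_wpM2r //.
    by rewrite divr_ge0 ?sqr_ge0 // ltW.
  by rewrite lerDl.
have g5 : q <= 4 * n * (B / K) ^+ 2.
  rewrite -(ler_pM2l K0).
  have -> : K * (4 * n * (B / K) ^+ 2) = 4 * (n * (B ^+ 2 / K)).
    by field; exact: lt0r_neq0.
  lra.
have BK : 0 <= B / K by rewrite divr_ge0 // ltW.
rewrite -ler_sqr ?nnegrE //; last by rewrite mulr_ge0 // divr_ge0 ?mulr_ge0 // ltW.
rewrite real_normK ?num_real //.
apply: le_trans (sqr_le_sqnorm (fun a => z a - z' a) a) _; apply: le_trans g5 _.
have -> : (2 * n / K * B) ^+ 2 = 4 * n * (B / K) ^+ 2 * n.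
  by field; exact: lt0r_neq0.
by rewrite ler_peMr // mulr_ge0 ?sqr_ge0 // mulr_ge0 // ltW.
Qed.

(* Compare [z] with the strategy obtained by moving all the mass of [a] to [b]. *)
Lemma choice_transfer (h : (A k -> R) -> R) (M : R) w z (a b : A k) :
  (forall z, simplex z -> `|h z| <= M) -> is_choice h w z ->
  z a * (w b - w a) <= 2 * M.
Proof.
move=> hM [zS zm]; pose z' c := z c + z a * ((pure b) c - (pure a) c).
have z'S : simplex z'.
  have [z0 z1] := zS; split=> [c|].
    rewrite /z' /pure; have [->|_] := eqVneq c a; last first.
      by rewrite subr0 addr_ge0 // mulr_ge0.
    by rewrite mulrBr mulr1 addrCA subrr addr0 mulr_ge0.
  by rewrite /z' big_split /= -mulr_sumr sumrB !(simplex_pure _).2 subrr mulr0 addr0.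
have := zm _ z'S; rewrite -/(pairing w z') -/(pairing w z).
have -> : pairing w z' = pairing w z + z a * (w b - w a).
  rewrite -[w b in RHS](pairing_pure w b) -[w a in RHS](pairing_pure w a).
  rewrite /pairing -sumrB mulr_sumr -big_split /=.
  by apply: eq_bigr => c _; rewrite /z'; ring.
have := hM _ z'S; have := hM _ zS; rewrite !ler_norml => /andP[? ?] /andP[? ?] ?.
lra.
Qed.

(* The minimiser [z] of [h + n |. - x|^2] is the choice for [w = -2 n (z - x)]. *)
Lemma choice_dense (h : (A k -> R) -> R) x (e : R) : penalty h -> simplex x -> 0 < e ->
  exists w z, is_choice h w z /\ forall a, `|z a - x a| <= e.
Proof.
move=> [hC _ [K K0 hK]] xS e0.
have s0 : @simplex R N A k !=set0 by exists x.
have [M M0 hM] := rel_continuous_bounded s0 hC.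
(* At the minimiser [n * |z - x|^2 <= h x - h z <= 2 * M], so this [n] forces [|z - x| <= e]. *)
have [n nE] : exists n, n = 2 * M / e ^+ 2 by eexists.
have n0 : 0 < n by rewrite nE divr_gt0 ?exprn_gt0 // mulr_gt0.
have [|z zS zm] := @simplex_min R N A k
    (fun z => h z + n * sqnorm (fun a => z a - x a)) s0.
  apply: (@rel_continuousD_lipschitz _ _ _ (2 * n) hC) => z z' zS z'S.
  rewrite -mulrBr normrM (gtr0_norm n0) [2 * n]mulrC -mulrA ler_wpM2l ?(ltW n0) //.
  rewrite /sqnorm -sumrB; apply: le_trans (ler_norm_sum _ _ _) _.
  rewrite /dist1 mulr_sumr; apply: ler_sum => a _.
  have -> : (z' a - x a) ^+ 2 - (z a - x a) ^+ 2
    = (z a + z' a - 2 * x a) * - (z a - z' a) by ring.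
  rewrite normrM normrN ler_wpM2r // ler_norml.
  have := zS.1 a; have := z'S.1 a; have := xS.1 a.
  have := simplex_le1 a zS; have := simplex_le1 a z'S; have := simplex_le1 a xS.
  by move=> *; apply/andP; split; lra.
exists (fun a => - 2 * n * (z a - x a)), z; split.
  split=> // z' z'S; rewrite -/(pairing _ z') -/(pairing _ z).
  (* Minimality is tested at [s z' + (1 - s) z]. Since [n * s = K / 2 * (1 - s)], the quadratic term
     of the expanded square cancels the one from strong convexity, and no limit [s -> 0] is
     taken. *)
  pose s := K / 2 / (n + K / 2).
  have nK : 0 < n + K / 2 by rewrite addr_gt0 // divr_gt0.
  have s_gt0 : 0 < s by rewrite !divr_gt0.
  have sE : n * s = K / 2 * (1 - s) by rewrite /s; field; rewrite lt0r_neq0 //; lra.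
  have s1 : s <= 1 by rewrite /s ler_pdivrMr // mul1r lerDr ltW.
  have s01 : 0 <= s <= 1 by rewrite s1 ltW.
  have := zm _ (simplex_convex z'S zS s01).
  have := hK _ _ z'S zS _ s01.
  have -> : sqnorm (fun a => s * z' a + (1 - s) * z a - x a)
    = sqnorm (fun a => z a - x a) + s ^+ 2 * sqnorm (fun a => z' a - z a)
      - s / n * (pairing (fun a => - 2 * n * (z a - x a)) z'
               - pairing (fun a => - 2 * n * (z a - x a)) z).
    rewrite /sqnorm /pairing -sumrB !mulr_sumr -big_split /= -sumrB.
    by apply: eq_bigr => a _; field; exact: lt0r_neq0.
  set q := sqnorm (fun a => z' a - z a); set P' := pairing _ z'; set P := pairing _ z.
  set u := sqnorm _ => h1 h2.
  have h3 : n * (u + s ^+ 2 * q - s / n * (P' - P)) = n * u + s * (n * s * q - (P' - P)).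
    by field; exact: lt0r_neq0.
  rewrite h3 sE in h2.
  rewrite -subr_ge0 -(pmulr_rge0 _ s_gt0); lra.
move=> a; rewrite -ler_sqr ?nnegrE ?(ltW e0) // real_normK ?num_real //.
apply: le_trans (sqr_le_sqnorm (fun a => z a - x a) a) _.
have := zm _ xS.
have -> : sqnorm (fun a => x a - x a) = 0.
  by rewrite /sqnorm big1 // => b _; rewrite subrr expr0n.
have := hM _ xS; have := hM _ zS; rewrite !ler_norml => /andP[? ?] /andP[? ?] ?.
rewrite -(ler_pM2l n0) {2}nE mulfVK ?expf_neq0 ?lt0r_neq0 //; lra.
Qed.
End Choice.

(* With [p = pure a], the Fenchel coupling
   [h p + max_x (\sum_b x b (w b - w a) - h x)] is monotone in the payoff gaps
   [w b - w a], controls [|Q w - p|^2], and is small when [Q w] is close to [p]. *)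
Lemma choice_vertex_stable {R : realType} {N : finType} {A : N -> finType} {k : N}
    (h : (A k -> R) -> R) (a : A k) (e : R) : penalty h -> 0 < e ->
  exists2 d : R, 0 < d & forall w w' : A k -> R,
    dist1 (choice_map h w) (pure a) < d ->
    (forall b, w' b - w' a <= w b - w a) ->
    forall b, `|choice_map h w' b - (pure a) b| <= e.
Proof.
move=> [hC _ [K K0 hK]] e0; have pS := @simplex_pure R N A k a.
have s0 : @simplex R N A k !=set0 by exists (pure a).
have [M M0 hM] := rel_continuous_bounded s0 hC.
(* Two errors of size [c] will bound [K / 4 * |z' - p|^2], whence [|z' - p| <= e]. *)
pose c := K / 8 * e ^+ 2.
have c0 : 0 < c by rewrite mulr_gt0 ?exprn_gt0 // divr_gt0.
have [d1 d10 hd1] := hC _ pS _ c0.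
pose d2 := c / (4 * M).
have d20 : 0 < d2 by rewrite divr_gt0 // mulr_gt0.
(* [d1] makes [h p - h z] at most [c]; [2^-1] keeps [z a] above one half, so that each gap
   [w i - w a] is at most [4 * M]; [d2] then makes the average gap at most [c]. *)
exists (Num.min d1 (Num.min d2 2^-1)).
  by rewrite !lt_min d10 d20 invr_gt0 ltr0n.
move=> w w'; have zc := choice_mapP w s0 hC; have zc' := choice_mapP w' s0 hC.
move: zc zc'; set z := choice_map h w; set z' := choice_map h w' => zc zc'.
have zS := zc.1; have z'S := zc'.1.
have distC : dist1 z (pure a) = dist1 (pure a) z.
  by apply: eq_bigr => b _; rewrite distrC.
rewrite !lt_min => /and3P[zd1 zd2 zd3] gap b.
have za : 1 - z a <= dist1 z (pure a).
  apply: le_trans (dist1_ge z (pure a) a); rewrite /pure eqxx mulr1n distrC.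
  exact: ler_norm.
have hh : h (pure a) - h z <= c.
  rewrite distC in zd1; have := hd1 _ zS zd1; rewrite ltr_norml => /andP[? _]; lra.
have g1 := choice_quadratic_gap hK zc' pS.
rewrite pairing_pure in g1.
have g2 := zc.2 _ z'S; rewrite -/(pairing w z) -/(pairing w z') in g2.
(* The gap hypothesis enters here: averaging with the nonnegative weights [z'] is monotone. *)
have g3 : pairing w' z' - w' a <= pairing w z' - w a.
  rewrite !pairing_gap //; apply: ler_sum => i _.
  by rewrite ler_wpM2l // z'S.1.
have g4 : pairing w z - w a <= 4 * M * (1 - z a).
  have -> : 1 - z a = \sum_(i | i != a) z i.
    by rewrite -zS.2 (bigD1 a) //= [z a + _]addrC addrK.
  rewrite pairing_gap // (bigD1 a) //= subrr mulr0 add0r mulr_sumr.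
  apply: ler_sum => i _; rewrite mulrC ler_wpM2r ?zS.1 //.
  have h1 := choice_transfer a i hM zc.
  have [g0|g0] := leP (w i - w a) 0.
    by apply: le_trans g0 _; rewrite mulr_ge0 // ltW.
  have : 2^-1 * (w i - w a) <= z a * (w i - w a) by rewrite ler_wpM2r ?(ltW g0) //; lra.
  by move=> ?; lra.
have g5 : 4 * M * (1 - z a) <= c.
  rewrite mulrC -ler_pdivlMr ?mulr_gt0 //; rewrite -/d2; lra.
have g6 : sqnorm (fun i => z' i - (pure a) i) <= e ^+ 2.
  have K4 : 0 < K / 4 by rewrite divr_gt0.
  rewrite -(ler_pM2l K4); move: g5 hh; rewrite /c; lra.
rewrite -ler_sqr ?nnegrE ?(ltW e0) // real_normK ?num_real //.
exact: le_trans (sqr_le_sqnorm (fun i => z' i - (pure a) i) b) g6.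
Qed.

(** * Multilinear payoffs *)

Section Payoff.
Context {R : realType} {N : finType} {A : N -> finType}.
Variable U : N -> @pprofile N A -> R.
Implicit Types (x y : @mprofile R N A).

(** [deviate] transports along a proof of [k = j]; equality in a [finType] is decidable, so a proof
    of [k = k] is [erefl]. *)
Lemma deviate_same x k (z : A k -> R) : deviate x k z k = z.
Proof. by rewrite /deviate; case: eqP => // e; rewrite (eq_irrelevance e erefl). Qed.

Lemma deviate_neq x k (z : A k -> R) j : j != k -> deviate x k z j = x j.
Proof. by rewrite /deviate; case: eqP => // e /eqP[]. Qed.

Lemma strategy_space_deviate x k (z : A k -> R) :
  strategy_space x -> simplex z -> strategy_space (deviate x k z).
Proof.
move=> xS zS j; have [->|jk] := eqVneq j k; first by rewrite deviate_same.
by rewrite deviate_neq //; exact: xS.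
Qed.

(** Multilinearity: the factor of player [k] splits off each product, and in the sum over pure
    actions [a] only [a = p k] survives. *)
Lemma exp_payoff_deviate x k (z : A k -> R) :
  exp_payoff U k (deviate x k z) = pairing (payvec U k x) z.
Proof.
pose P (p : pprofile) := \prod_(j | j != k) x j (p j).
have dE (z' : A k -> R) (p : pprofile) :
    \prod_j deviate x k z' j (p j) = z' (p k) * P p.
  rewrite (bigD1 k) //= deviate_same; congr (_ * _).
  by apply: eq_bigr => j jk; rewrite deviate_neq.
rewrite /pairing /payvec /exp_payoff.
under [RHS]eq_bigr do rewrite mulr_suml.
rewrite exchange_big /=; apply: eq_bigr => p _; rewrite dE.
rewrite (bigD1 (p k)) //= dE /pure eqxx mul1r big1 ?addr0; first by ring.
by move=> a /negbTE ak; rewrite dE eq_sym ak mul0r mulr0 mul0r.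
Qed.

Lemma exp_payoffE x k : exp_payoff U k x = pairing (payvec U k x) (x k).
Proof.
rewrite -exp_payoff_deviate; congr exp_payoff; apply: functional_extensionality_dep => j.
have [->|jk] := eqVneq j k; first by rewrite deviate_same.
by rewrite deviate_neq.
Qed.

Lemma nash_of_support x : strategy_space x ->
  (forall k a b, 0 < x k a -> payvec U k x b <= payvec U k x a) -> nash U x.
Proof.
move=> xS H k z [z0 z1]; have [x0 x1] := xS k.
rewrite exp_payoff_deviate exp_payoffE.
(* Averaging the left side over [x k], and then each right-hand term over [z], reduces the claim to
   comparing [b] with a supported [a]. *)
rewrite -[leLHS]mulr1 -x1 mulr_sumr; apply: ler_sum => a _.
have [xa|xa] := ltP 0 (x k a); last first.
  by have -> : x k a = 0; [apply/eqP; rewrite eq_le xa x0|rewrite !mulr0].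
rewrite ler_wpM2r // -[leRHS]mulr1 -z1 mulr_sumr; apply: ler_sum => b _.
by rewrite ler_wpM2r // H.
Qed.

(** Telescoping: factors are exchanged one at a time, and the others, lying in [[0, 1]], do not
    enlarge the difference. *)
Lemma norm_prodB_le (I : finType) (f g : I -> R) :
  (forall i, 0 <= f i <= 1) -> (forall i, 0 <= g i <= 1) ->
  `|\prod_i f i - \prod_i g i| <= \sum_i `|f i - g i|.
Proof.
move=> f01 g01; elim: (index_enum I) => [|i r IH].
  by rewrite !big_nil subrr normr0.
rewrite !big_cons; set P := \prod_(j <- r) f j; set Q := \prod_(j <- r) g j in IH *.
have -> : f i * P - g i * Q = (f i - g i) * P + g i * (P - Q) by ring.
have P01 : 0 <= P <= 1.
  rewrite prodr_ge0 => [|j _]; last by have /andP[] := f01 j.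
  by apply: prodr_ile1 => j _; exact: f01.
apply: le_trans (ler_normD _ _) _; rewrite !normrM; apply: lerD.
  by rewrite ler_piMr // ger0_norm; have /andP[] := P01.
apply: le_trans IH; have /andP[g0 g1] := g01 i.
by rewrite ler_piMl // ger0_norm.
Qed.

Lemma payvec_lipschitz : exists2 l : R, 0 < l &
  forall x x' (B : R), strategy_space x -> strategy_space x' ->
    (forall k a, `|x k a - x' k a| <= B) ->
    forall k a, `|payvec U k x a - payvec U k x' a| <= l * B.
Proof.
(* Summing over all players makes the constant independent of [k]. *)
pose S := \sum_k \sum_p `|U k p|.
have S0 : 0 <= S by rewrite sumr_ge0 // => k _; rewrite sumr_ge0.
pose l := S * #|N|%:R + 1.
exists l; first by rewrite ltr_wpDl // mulr_ge0.
move=> x x' B xS x'S xB k a.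
have B0 : 0 <= B := le_trans (normr_ge0 _) (xB k a).
have in01 x1 j b : strategy_space x1 -> 0 <= deviate x1 k (pure a) j b <= 1.
  move=> x1S; have dS := strategy_space_deviate x1S (@simplex_pure R N A k a).
  by rewrite (dS j).1 (simplex_le1 b (dS j)).
have dB j b : `|deviate x k (pure a) j b - deviate x' k (pure a) j b| <= B.
  have [jk|jk] := eqVneq j k; last by rewrite !deviate_neq.
  by subst j; rewrite !deviate_same subrr normr0.
rewrite /payvec /exp_payoff -sumrB; apply: le_trans (ler_norm_sum _ _ _) _.
apply: (@le_trans _ _ (\sum_p `|U k p| * (#|N|%:R * B))).
  apply: ler_sum => p _; rewrite -mulrBr normrM ler_wpM2l //.
  apply: le_trans (norm_prodB_le _ _) _ => [j|j|]; [exact: in01|exact: in01|].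
  rewrite mulr_natl -sumr_const; apply: ler_sum => j _; exact: dB.
rewrite -mulr_suml /l mulrDl mul1r -mulrA; apply: (@le_trans _ _ (S * (#|N|%:R * B))).
  rewrite ler_wpM2r ?mulr_ge0 // /S (bigD1 k) //= lerDl sumr_ge0 // => j _.
  by rewrite sumr_ge0.
by rewrite lerDl.
Qed.
End Payoff.

Unset Implicit Arguments.

(** * Distance between mixed profiles *)

Section Distance.
Context {R : realType} {N : finType} {A : N -> finType}.
Implicit Types x w : @mprofile R N A.

Lemma dist_ge x w k a : `|x k a - w k a| <= dist x w.
Proof.
apply: le_trans (dist1_ge (x k) (w k) a) _.
by rewrite /dist (bigD1 k) //= lerDl sumr_ge0 // => j _; rewrite /dist1 sumr_ge0.
Qed.

Lemma dist1_le_dist x w k : dist1 (x k) (w k) <= dist x w.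
Proof.
by rewrite /dist (bigD1 k) //= lerDl sumr_ge0 // => j _; rewrite /dist1 sumr_ge0.
Qed.

(** Turns coordinatewise estimates into [dist]-neighborhoods. With [n] actions in total, the
    denominator [n + 1] makes the inequality strict and covers [n = 0]. *)
Lemma dist_lt_of_coord (e : R) : 0 < e -> exists2 e1 : R, 0 < e1 &
  forall x w, (forall k a, `|x k a - w k a| <= e1) -> dist x w < e.
Proof.
move=> e0; pose n : R := \sum_(k : N) \sum_(a : A k) 1.
have n0 : 0 <= n by rewrite sumr_ge0 // => k _; rewrite sumr_ge0.
have n1 : 0 < n + 1 by rewrite ltr_wpDl.
exists (e / (n + 1)); first by rewrite divr_gt0.
move=> x w xw; apply: (@le_lt_trans _ _ (n * (e / (n + 1)))).
  rewrite /dist /dist1 /n mulr_suml; apply: ler_sum => k _.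
  by rewrite mulr_suml; apply: ler_sum => a _; rewrite mul1r.
by rewrite mulrA ltr_pdivrMr // mulrC ltr_pM2l // ltrDl.
Qed.

End Distance.

(** * Orbits *)

Section Dynamics.
Context {R : realType} {N : finType} {A : N -> finType}.
Variables (U : N -> @pprofile N A -> R) (h : forall k, (A k -> R) -> R).
Hypothesis hpen : forall k, penalty (h k).
Variable xs : @mprofile R N A.
Hypothesis hxs : strategy_space xs.
Implicit Types (x w : @mprofile R N A) (y : R -> @mprofile R N A).

Let simplex_neq0 k : @simplex R N A k !=set0.
Proof. by exists (xs k). Qed.

Let hcont k : rel_continuous (@simplex R N A k) (h k).
Proof. by case: (hpen k). Qed.

Lemma QmapP w k : is_choice (h k) (w k) (Qmap h w k).
Proof. exact: choice_mapP. Qed.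

Lemma strategy_space_Qmap w : strategy_space (Qmap h w).
Proof. by move=> k; exact: (QmapP w k).1. Qed.

Lemma Qmap_lipschitz : exists2 l : R, 0 < l & forall w w' (B : R),
  (forall k a, `|w k a - w' k a| <= B) -> forall k a, `|Qmap h w k a - Qmap h w' k a| <= l * B.
Proof.
have /choice[l lP] : forall k, exists r : R, 0 < r /\
    forall a, sup_lipschitz r (fun v => choice_map (h k) v a).
  by move=> k; have [r r0 H] := choice_lipschitz (hpen k) (simplex_neq0 k); exists r.
exists (\sum_k l k + 1).
  by rewrite ltr_wpDl // sumr_ge0 // => k _; apply/ltW; exact: (lP k).1.
move=> w w' B wB k a; apply: le_trans ((lP k).2 a _ _ _ (wB k)) _.
rewrite ler_wpM2r ?(le_trans (normr_ge0 _) (wB k a)) // (bigD1 k) //= -addrA lerDl.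
by rewrite addr_ge0 // sumr_ge0 // => j _; apply/ltW; exact: (lP j).1.
Qed.

Lemma field_lipschitz : exists2 l : R, 0 < l & forall w w' (B : R),
  (forall k a, `|w k a - w' k a| <= B) ->
  forall k a, `|payvec U k (Qmap h w) a - payvec U k (Qmap h w') a| <= l * B.
Proof.
have [l1 l10 H1] := Qmap_lipschitz; have [l2 l20 H2] := payvec_lipschitz U.
exists (l2 * l1); first exact: mulr_gt0.
move=> w w' B wB k a; rewrite -mulrA.
by apply: H2; [exact: strategy_space_Qmap|exact: strategy_space_Qmap|exact: H1].
Qed.

Lemma solution_exists w : exists2 y, is_solution U h y & y 0 = w.
Proof.
have [l l0 H] := field_lipschitz.
(* Profiles are flattened to functions on the finite type of pairs (player, action), the form in
   which [picard_lindelof] applies. *)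
pose prof (u : {k & A k} -> R) : @mprofile R N A := fun k a => u (Tagged (fun k => A k) a).
pose f u (i : {k & A k}) := payvec U (tag i) (Qmap h (prof u)) (tagged i).
have fl i : sup_lipschitz l (f ^~ i).
  by move=> u v B uB; apply: H => k a; exact: uB.
have [y [y0 dy]] := picard_lindelof (fun i => w (tag i) (tagged i)) l0 fl.
have dy' k a (t : R) : 0 <= t -> is_derive t 1 (fun s => prof (y s) k a)
    (payvec U k (Qmap h (prof (y t))) a).
  by move=> t0; exact: (dy (Tagged (fun k => A k) a) t t0).
exists (fun t => prof (y t)).
  split=> [k a t /ltW|k a]; first exact: dy'.
  apply: cvg_at_right_filter; exact: is_derive_continuous (dy' k a 0 (lexx _)).
by apply: functional_extensionality_dep => k; apply/funext => a; rewrite /prof y0.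
Qed.

(** Common core of (I), (II) and (III): each of their hypotheses yields, for every tolerance, an
    orbit that eventually stays that close to [xs]. *)
Lemma nash_of_nearby_orbits :
  (forall e : R, 0 < e -> exists y (T : R), [/\ is_solution U h y, 0 <= T &
     forall t : R, T <= t -> forall k a, `|Qmap h (y t) k a - xs k a| <= e]) ->
  nash U xs.
Proof.
move=> H; apply: nash_of_support => // k a b xa; rewrite leNgt; apply/negP => vab.
have [l l0 lP] := payvec_lipschitz U.
have [M M0 hM] := rel_continuous_bounded (simplex_neq0 k) (hcont k).
pose c := payvec U k xs b - payvec U k xs a.
have c0 : 0 < c by rewrite subr_gt0.
(* The first bound keeps the weight of [a] at least [xs k a / 2]; the second moves each payoff by at
   most [c / 4], so [b] keeps an advantage of at least [c / 2]. *)
pose e := Num.min (xs k a / 2) (c / (4 * l)).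
have e0 : 0 < e by rewrite lt_min !divr_gt0 // mulr_gt0.
have [y [T [[dy _] T0 yT]]] := H _ e0.
(* A positive starting time, where [y] is differentiable. *)
pose T1 := T + 1.
have T10 : 0 < T1 by rewrite ltr_wpDl.
pose F (t : R) := y t k a - y t k b + c / 2 * t.
pose d (t : R) := payvec U k (Qmap h (y t)) a - payvec U k (Qmap h (y t)) b + c / 2.
have dF (t : R) : 0 < t -> is_derive t 1 F (d t).
  move=> t0; apply: (@is_deriveD _ _ _ (fun t => y t k a - y t k b) (fun t => c / 2 * t)).
    by apply: (@is_deriveB _ _ _ (fun t => y t k a) (fun t => y t k b)); exact: dy.
  exact: is_derive_mull.
have d0 (t : R) : T <= t -> d t <= 0.
  move=> Tt; have B := lP _ _ e (strategy_space_Qmap (y t)) hxs (yT t Tt) k.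
  have le4 : l * e <= c / 4.
    have : e <= c / (4 * l) by rewrite ge_min lexx orbT.
    rewrite -(ler_pM2l l0) => /le_trans; apply.
    by rewrite le_eqVlt; apply/orP; left; apply/eqP; field; exact: lt0r_neq0.
  have := B a; have := B b; rewrite !ler_norml => /andP[? ?] /andP[? ?].
  rewrite /d; rewrite /c in le4 *; lra.
have Fle (t : R) : T1 <= t -> F t <= F T1.
  move=> T1t; apply: (@derive_le0_le R F d) => // [s /andP[/(lt_trans T10) s0 _]||s /andP[Ts _]].
  - exact: dF.
  - apply: cvg_at_right_filter; exact: is_derive_continuous (dF _ T10).
  - by apply: d0; apply: le_trans (ltW Ts); rewrite lerDl.
(* A score gap [G] contradicts the weight of [a], since [xs k a / 2 * G > 2 * M]; the time [t] below
   is one by which a drift of rate [c / 2] has produced it. *)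
pose G := 4 * M / xs k a + 1.
have G0 : 0 < G by rewrite ltr_wpDl // divr_ge0 ?mulr_ge0 // ltW.
pose t := T1 + 2 * (`|F T1| + G) / c.
have T1t : T1 <= t.
  rewrite lerDl; apply: divr_ge0; last exact: ltW.
  by apply: mulr_ge0 => //; apply: addr_ge0 => //; exact: ltW.
have gap : G <= y t k b - y t k a.
  have := Fle _ T1t; rewrite {1}/F.
  have -> : c / 2 * t = c / 2 * T1 + (`|F T1| + G).
    by rewrite /t; field; exact: lt0r_neq0.
  have := ler_norm (F T1); have : 0 <= c / 2 * T1 by rewrite mulr_ge0 ?divr_ge0 // ltW.
  by lra.
have Tt : T <= t by apply: le_trans T1t; rewrite lerDl.
have za : xs k a / 2 <= Qmap h (y t) k a.
  have : e <= xs k a / 2 by rewrite ge_min lexx.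
  have := yT _ Tt k a; rewrite ler_norml => /andP[? ?] ?; lra.
have := choice_transfer a b hM (QmapP (y t) k); apply/negP; rewrite -ltNge.
apply: (@lt_le_trans _ _ (xs k a / 2 * G)).
  have -> : xs k a / 2 * G = 2 * M + xs k a / 2.
    by rewrite /G; field; exact: lt0r_neq0.
  by rewrite ltrDl divr_gt0.
by apply: ler_pM => //; [rewrite divr_ge0 // ltW|exact: ltW].
Qed.

Lemma stationary_nash : stationary U h xs -> nash U xs.
Proof.
move=> [[w _ wxs] xst]; apply: nash_of_nearby_orbits => e e0.
have [y ysol y0] := solution_exists w.
exists y, 0; split => // t t0 k a.
by rewrite (xst y ysol) ?y0 // subrr normr0 ltW.
Qed.

Lemma limit_nash y : is_solution U h y -> orbit_converges h y xs -> nash U xs.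
Proof.
move=> ysol ycvg; apply: nash_of_nearby_orbits => e e0.
have : \forall t \near +oo, forall k a, `|xs k a - Qmap h (y t) k a| <= e.
  apply: filter_forall => k; apply: filter_forall => a.
  by move/cvgrPdist_le: (ycvg k a); apply.
(* The filter gives a threshold of unknown sign and a strict bound; [|T| + 1] serves for both. *)
move=> [T [_ TP]]; exists y, (`|T| + 1); split => // t Tt k a.
rewrite distrC; apply: TP; apply: lt_le_trans Tt.
by apply: le_lt_trans (ler_norm T) _; rewrite ltrDl.
Qed.

(** [xs] may lie outside the image of [Q], so the orbit starts from a nearby point of the image,
    found by density player by player. *)
Lemma lyapunov_stable_nash : lyapunov_stable U h xs -> nash U xs.
Proof.
move=> st; apply: nash_of_nearby_orbits => e /[dup] e0 /st[d d0 dP].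
have [e1 e10 e1P] := dist_lt_of_coord (R := R) (A := A) d d0.
have wex : forall k, exists w : A k -> R, forall a, `|choice_map (h k) w a - xs k a| <= e1.
  move=> k; have [w [z [zc zx]]] := choice_dense (hpen k) (hxs k) e10.
  by exists w; rewrite (choice_map_eq (hpen k) zc).
pose w k := sval (cid (wex k)); have wP k := svalP (cid (wex k)).
have [y ysol y0] := solution_exists w.
exists y, 0; split => // t t0 k a; apply: le_trans (dist_ge _ _ k a) _; apply/ltW.
apply: dP => //; first exact: strategy_space_Qmap.
  by exists (y 0).
by rewrite y0; apply: e1P.
Qed.
(* [t |-> y 0 + t v(xs)] is a solution with constant orbit [xs]; it coincides with
   [y] because the Picard estimate contracts their difference. *)
Lemma nash_stationary : nash U xs -> image_Q h xs -> stationary U h xs.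
Proof.
move=> xN xim; split=> // y [dy cy] y0 t t0.
pose w (s : R) : @mprofile R N A := fun k a => y 0 k a + payvec U k xs a * s.
(* The drift adds [s] times the pairing with [v(xs)] to the objective, and by the Nash property [xs]
   maximises that term as well. *)
have Qw (s : R) : 0 <= s -> Qmap h (w s) = xs.
  move=> s0; apply: functional_extensionality_dep => k; apply: choice_map_eq => //.
  have [_ opt] := QmapP (y 0) k; rewrite y0 in opt.
  split; first exact: hxs.
  move=> z zS; have := opt z zS; have := xN k z zS.
  rewrite exp_payoff_deviate exp_payoffE => v1.
  have wE (z' : A k -> R) : \sum_a w s k a * z' a
      = \sum_a y 0 k a * z' a + s * pairing (payvec U k xs) z'.
    by rewrite /pairing mulr_sumr -big_split /=; apply: eq_bigr => a _; rewrite /w; ring.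
  rewrite !wE => v2; have := ler_wpM2l s0 v1; lra.
have [l l0 lP] := field_lipschitz.
have step (B : R) : (forall s : R, 0 < s -> forall k a,
      `|payvec U k (Qmap h (y s)) a - payvec U k xs a|
        <= B * (2 * l) * expR (2 * l * s)) -> 0 <= B ->
    forall s : R, 0 <= s -> forall k a, `|y s k a - w s k a| <= B * expR (2 * l * s).
  move=> HB B0 s s0 k a.
  have dw (r : R) : is_derive r 1 (fun r => w r k a) (payvec U k xs a).
    have := is_deriveD (is_derive_cst (y 0 k a) r 1) (is_derive_mull (payvec U k xs a) r).
    by rewrite add0r.
  apply: (@expR_weighted_bound R (fun r => y r k a - w r k a)
    (fun r => payvec U k (Qmap h (y r)) a - payvec U k xs a) B (2 * l)) => //.
  - exact: mulr_gt0.
  - by rewrite /w mulr0 addr0 subrr.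
  - apply: cvgB; first exact: cy.
    apply: cvg_at_right_filter; exact: is_derive_continuous (dw 0).
  - move=> r r0; apply: (@is_deriveB _ _ _ (fun r => y r k a) (fun r => w r k a)).
    exact: dy.
  - by move=> r r0; exact: HB.
have [l2 l20 l2P] := payvec_lipschitz U.
(* Weights lie in [[0, 1]], so two payoffs differ by at most [l2 = C * (2 * l)], which starts the
   induction. *)
pose C := l2 / (2 * l).
have C0 : 0 < C by rewrite divr_gt0 // mulr_gt0.
have contr n (s : R) : 0 <= s -> forall k a,
    `|y s k a - w s k a| <= C / 2 ^+ n * expR (2 * l * s).
  elim: n s => [|n IH] s s0 k a.
    rewrite expr0 divr1; apply: step => //; last exact: ltW.
    move=> r r0 j b; apply: (@le_trans _ _ (l2 * 1)).
      apply: l2P => // [|i c]; first exact: strategy_space_Qmap.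
      have [z0 z1] := (strategy_space_Qmap (y r) i, hxs i).
      have := z0.1 c; have := z1.1 c.
      have := simplex_le1 c z0; have := simplex_le1 c z1.
      by move=> *; rewrite ler_norml; apply/andP; split; lra.
    have -> : C * (2 * l) = l2 by rewrite /C; field; exact: lt0r_neq0.
    rewrite ler_pM2l // -expR0 ler_expR mulr_ge0 ?mulr_ge0 // ltW //.
  have B0 : 0 <= C / 2 ^+ n.+1 by apply: divr_ge0; [exact: ltW|exact: exprn_ge0].
  apply: step => // r /ltW r0 j b.
  have -> : C / 2 ^+ n.+1 * (2 * l) * expR (2 * l * r)
      = l * (C / 2 ^+ n * expR (2 * l * r)).
    rewrite exprS; have : (2 : R) ^+ n != 0 by rewrite expf_neq0.
    by clearbody C; move=> ?; field.
  rewrite -(Qw r r0); apply: lP; exact: IH.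
rewrite -(Qw t t0); congr Qmap.
apply: functional_extensionality_dep => k; apply/funext => a.
apply/eqP; rewrite -subr_eq0 -normr_le0; apply/ler_addgt0Pl => e.
move=> /(exists_divX2_lt (C * expR (2 * l * t)))[n nP]; rewrite addr0.
apply: le_trans (ltW nP); apply: le_trans (contr n t t0 k a) _.
by rewrite mulrAC.
Qed.

(** * Asymptotic stability of strict equilibria *)

Lemma strict_nash_vertex k : strict_nash U xs ->
  exists a : A k, xs k = pure a /\
    forall b, b != a -> payvec U k xs b < payvec U k xs a.
Proof.
move=> sN; have [a0 _] := simplex_inhabited (hxs k).
case: (@arg_maxP _ _ (A k) a0 xpredT (payvec U k xs) isT) => a _ amax.
(* A best pure reply [a] pays at least the average, so deviating to it is not a strict loss;
   strictness leaves only [xs k = pure a]. *)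
have le_a : exp_payoff U k xs <= payvec U k xs a.
  rewrite exp_payoffE -subr_le0 pairing_gap //; apply: sumr_le0 => b _.
  by rewrite mulr_ge0_le0 ?(hxs k).1 // subr_le0; exact: amax.
have [xa|xa] := pselect (xs k = pure a); last first.
  have := sN k (pure a) (simplex_pure a) (not_eq_sym xa).
  by rewrite exp_payoff_deviate pairing_pure ltNge le_a.
exists a; split=> // b ba.
have := sN k (pure b) (simplex_pure b).
rewrite exp_payoff_deviate pairing_pure exp_payoffE {2}xa pairing_pure; apply.
rewrite xa => /(congr1 (fun f => f b)); rewrite /pure eqxx (negbTE ba) => /eqP.
by rewrite oner_eq0.
Qed.

Lemma solution_right_continuous y k a (t : R) : is_solution U h y -> 0 <= t ->
  y s k a @[s --> t^'+] --> y t k a.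
Proof.
move=> [dy cy]; rewrite le_eqVlt => /predU1P[<-|t0]; first exact: cy.
by apply: cvg_at_right_filter; exact: is_derive_continuous (dy k a t t0).
Qed.

(** Used to rule out a first exit from a neighborhood: a strict bound at one time persists for a
    short while after it. *)
Lemma dist_orbit_right_continuous y (t : R) : is_solution U h y -> 0 <= t ->
  dist (Qmap h (y s)) xs @[s --> t^'+] --> dist (Qmap h (y t)) xs.
Proof.
move=> ysol t0; apply: cvg_sumr => k; apply: cvg_sumr => a.
apply: cvg_norm; apply: cvgB; last exact: cvg_cst.
have [l l0 lP] := choice_lipschitz (hpen k) (simplex_neq0 k).
apply: (sup_lipschitz_cvg l0 (lP a)) => b.
exact: solution_right_continuous.
Qed.

(** A bootstrap: nearness to [xs] makes the score gaps decrease, and smaller gaps imply nearness by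
    [choice_vertex_stable]. The distance bound gives stability, the linear decrease of the gaps
    gives attraction. *)
Lemma strict_nash_trap : strict_nash U xs ->
  exists (a : forall k, A k) (c : R), [/\ 0 < c, forall k, xs k = pure (a k) &
    forall e : R, 0 < e -> exists2 d : R, 0 < d & forall y, is_solution U h y ->
      dist (Qmap h (y 0)) xs < d -> forall t : R, 0 <= t ->
        dist (Qmap h (y t)) xs < e /\
        forall k b, b != a k ->
          y t k b - y t k (a k) + c * t <= y 0 k b - y 0 k (a k)].
Proof.
move=> sN; pose a k := sval (cid (strict_nash_vertex k sN)).
have xa k : xs k = pure (a k) by have [] := svalP (cid (strict_nash_vertex k sN)).
have va k b : b != a k -> payvec U k xs b < payvec U k xs (a k).
  by have [_ +] := svalP (cid (strict_nash_vertex k sN)); apply.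
(* A payoff margin common to all players: a finite minimum capped at [1], which also covers the case
   of no alternative action. *)
have [g g0 gP] : exists2 g : R, 0 < g & forall k b, b != a k ->
    g <= payvec U k xs (a k) - payvec U k xs b.
  pose G (i : {k & A k}) := payvec U (tag i) xs (a (tag i)) - payvec U (tag i) xs (tagged i).
  exists (\big[Num.min/1]_(i | tagged i != a (tag i)) G i).
    by apply: lt_bigmin => // i /va; rewrite subr_gt0.
  move=> k b bk; exact: (bigmin_le_cond 1 (j := Tagged (fun k => A k) b)
    (P := fun i => tagged i != a (tag i)) G bk).
have [l l0 lP] := payvec_lipschitz U.
pose c := g / 2; have c0 : 0 < c by rewrite divr_gt0.
(* Within radius [r] each payoff moves by at most [l * r = g / 4], so the margin stays at least
   [g / 2 = c]. *)
pose r := g / (4 * l); have r0 : 0 < r by rewrite divr_gt0 // mulr_gt0.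
have lr : l * r = g / 4 by rewrite /r; field; exact: lt0r_neq0.
have drift x : strategy_space x -> dist x xs < r -> forall k b, b != a k ->
    payvec U k x b - payvec U k x (a k) <= - c.
  move=> xS xr k b bk.
  have H := lP x xs r xS hxs (fun k a => le_trans (dist_ge x xs k a) (ltW xr)) k.
  have := H b; have := H (a k); have := gP k b bk.
  by rewrite !ler_norml lr /c => ? /andP[? ?] /andP[? ?]; lra.
exists a, c; split=> // e e0.
pose e1 := Num.min e r; have e10 : 0 < e1 by rewrite lt_min e0.
have [e2 e20 e2P] := dist_lt_of_coord (R := R) (A := A) e1 e10.
have /choice[dk dkP] : forall k, exists d : R, 0 < d /\ forall w w' : A k -> R,
    dist1 (choice_map (h k) w) (xs k) < d ->
    (forall b, w' b - w' (a k) <= w b - w (a k)) ->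
    forall b, `|choice_map (h k) w' b - xs k b| <= e2.
  move=> k; have [d d0 dP] := choice_vertex_stable (a k) (hpen k) e20.
  by exists d; rewrite xa.
exists (\big[Num.min/1]_k dk k).
  by apply: lt_bigmin => // k _; exact: (dkP k).1.
move=> y ysol y0d.
(* Scores at time [t] are compared directly with those at time [0], so errors do not accumulate. *)
have vertex (t : R) : (forall k b, y t k b - y t k (a k) <= y 0 k b - y 0 k (a k)) ->
    dist (Qmap h (y t)) xs < e1.
  move=> gap; apply: e2P => k; apply: ((dkP k).2 (y 0 k)) => //.
  apply: le_lt_trans (dist1_le_dist (Qmap h (y 0)) xs k) _.
  by apply: lt_le_trans y0d _; exact: bigmin_le_cond.
(* Nearness is assumed on the open interval only, so the conclusion holds at a first exit time
   too. *)
have gap (t : R) : 0 <= t -> (forall s : R, 0 < s < t -> dist (Qmap h (y s)) xs < e1) ->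
    forall k b, b != a k -> y t k b - y t k (a k) + c * t <= y 0 k b - y 0 k (a k).
  move=> t0 near k b bk.
  have := @derive_le0_le R (fun s => y s k b - y s k (a k) + c * s)
    (fun s => payvec U k (Qmap h (y s)) b - payvec U k (Qmap h (y s)) (a k) + c) 0 t t0.
  rewrite mulr0 addr0; apply.
  - move=> s /andP[s0 _].
    apply: (@is_deriveD _ _ _ (fun s => y s k b - y s k (a k)) (fun s => c * s)).
      by apply: (@is_deriveB _ _ _ (fun s => y s k b) (fun s => y s k (a k)));
        exact: ysol.1.
    exact: is_derive_mull.
  - rewrite -[X in _ --> X]addr0 -[X in _ --> _ + X](mulr0 c); apply: cvgD.
      by apply: cvgB; exact: solution_right_continuous.
    by apply: cvg_at_right_filter; exact: is_derive_continuous (is_derive_mull c 0).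
  - move=> s st; rewrite -lerBrDr sub0r; apply: drift => //.
      exact: strategy_space_Qmap.
    by apply: lt_le_trans (near s st) _; rewrite ge_min lexx orbT.
have gap' (t : R) : 0 <= t -> (forall s : R, 0 < s < t -> dist (Qmap h (y s)) xs < e1) ->
    dist (Qmap h (y t)) xs < e1.
  move=> t0 near; apply: vertex => k b.
  have [->|bk] := eqVneq b (a k); first by rewrite !subrr.
  apply: le_trans (gap t t0 near k b bk); rewrite lerDl mulr_ge0 //; exact: ltW.
have stay (t : R) : 0 <= t -> dist (Qmap h (y t)) xs < e1.
  move=> t0; rewrite ltNge; apply/negP => bad.
  pose E := [set s : R | 0 <= s /\ e1 <= dist (Qmap h (y s)) xs].
  have Einf : has_inf E by split; [exists t|exists 0 => s []].
  pose m := inf E.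
  have m0 : 0 <= m by apply: lb_le_inf => [|s []]; first exact: Einf.1.
  have before (s : R) : 0 <= s -> s < m -> dist (Qmap h (y s)) xs < e1.
    move=> s0; apply: contraTT; rewrite -!leNgt => es.
    by apply: ge_inf => //; exact: Einf.2.
  have atm : dist (Qmap h (y m)) xs < e1.
    by apply: gap' => // s /andP[/ltW s0 sm]; exact: before.
  (* The infimum [m] of the exit times is not an exit time, and right continuity excludes exit times
     just after [m], contradicting that [m] is the infimum. *)
  have /cvgr_lt/(_ _ atm) := dist_orbit_right_continuous y m ysol m0.
  move=> [/= q q0 qP].
  have [s [s0 es] sm] := inf_adherent q0 Einf.
  have : m <= s by apply: ge_inf => //; exact: Einf.2.
  rewrite le_eqVlt => /predU1P[ms|ms].
    by move: es; rewrite -ms leNgt atm.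
  move: es; rewrite leNgt => /negP; apply; apply: qP => //=.
  by rewrite ltr0_norm ?subr_lt0 // opprB ltrBlDl.
move=> t t0; split.
  by apply: lt_le_trans (stay t t0) _; rewrite ge_min lexx.
by apply: gap => // s /andP[/ltW s0 _]; exact: stay.
Qed.

Lemma strict_nash_asymptotically_stable :
  strict_nash U xs -> asymptotically_stable U h xs.
Proof.
move=> /strict_nash_trap[a [c [c0 xa trap]]]; split.
  move=> e /trap[d d0 dP]; exists d => // y ysol _ _ yd t t0.
  exact: (dP y ysol yd t t0).1.
(* The radius [1] is arbitrary: attraction uses only the linear decrease of the gaps. *)
have [d d0 dP] := trap 1 ltr01; exists d => // y ysol _ _ yd.
have decay k b (e : R) : b != a k -> 0 < e ->
    \forall t \near +oo, Qmap h (y t) k b <= e.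
  move=> bk e0.
  have [M M0 hM] := rel_continuous_bounded (simplex_neq0 k) (hcont k).
  pose g := y 0 k b - y 0 k (a k).
  near=> t.
  have t0 : 0 <= t by near: t; apply: nbhs_pinfty_ge; exact: num_real.
  (* From this time on the gap in favour of [a k] is at least [2 * M / e], and [choice_transfer]
     leaves [b] a weight of at most [e]. *)
  have tT : (2 * M / e + g) / c <= t by near: t; apply: nbhs_pinfty_ge; exact: num_real.
  have := (dP y ysol yd t t0).2 k b bk; rewrite -/g => gap.
  have := choice_transfer b (a k) hM (QmapP (y t) k).
  have big : 2 * M / e <= y t k (a k) - y t k b.
    move: tT; rewrite ler_pdivrMr // mulrC => tT; lra.
  have z0 : 0 <= Qmap h (y t) k b := (strategy_space_Qmap (y t) k).1 b.
  move=> /(le_trans (ler_wpM2l z0 big)).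
  have M2 : 0 < 2 * M by rewrite mulr_gt0.
  by rewrite mulrA ler_pdivrMr // mulrC ler_pM2l.
move=> k b; apply/cvgrPdist_le => e e0.
have [->|bk] := eqVneq b (a k); last first.
  apply: filterS (decay k b e bk e0) => t te.
  rewrite xa /pure (negbTE bk) sub0r normrN ger0_norm //.
  exact: (strategy_space_Qmap (y t) k).1.
(* The equilibrium action lacks exactly the total weight of the others, each of which is eventually
   at most [e / n]. *)
pose n : R := #|A k|%:R + 1.
have n0 : 0 < n by rewrite ltr_wpDl.
have en0 : 0 < e / n by rewrite divr_gt0.
have : \forall t \near +oo, forall b', b' != a k -> Qmap h (y t) k b' <= e / n.
  apply: filter_forall => b'; have [bk|_] := boolP (b' != a k); last by near=> t.
  by apply: filterS (decay k b' _ bk en0).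
apply: filterS => t H.
have [z0 z1] := strategy_space_Qmap (y t) k.
have -> : xs k (a k) - Qmap h (y t) k (a k) = \sum_(b' | b' != a k) Qmap h (y t) k b'.
  by rewrite xa /pure eqxx mulr1n -z1 (bigD1 (a k)) //= [_ (a k) + _]addrC addrK.
rewrite ger0_norm ?sumr_ge0 //.
apply: (@le_trans _ _ (\sum_(b' : A k) e / n)).
  rewrite big_mkcond /=; apply: ler_sum => b' _.
  by case: ifP => [/H //|_]; exact: ltW.
rewrite sumr_const -mulr_natl mulrA ler_pdivrMr // mulrC ler_pM2l // lerDl //.
Unshelve. all: by end_near.
Qed.
End Dynamics.

Theorem theorem5p1 (R : realType) (N : finType) (A : N -> finType)
    (U : N -> @pprofile N A -> R) (h : forall k, (A k -> R) -> R)
    (hpen : forall k, penalty (h k))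
    (xs : @mprofile R N A) (hxs : strategy_space xs) :
  [/\ (stationary U h xs -> nash U xs) /\
        (nash U xs -> image_Q h xs -> stationary U h xs),
      (forall y : R -> @mprofile R N A, is_solution U h y ->
         orbit_converges h y xs -> nash U xs),
      (lyapunov_stable U h xs -> nash U xs)
    & (strict_nash U xs -> asymptotically_stable U h xs)].
Proof.
split; first split.
- exact: stationary_nash.
- exact: nash_stationary.
- exact: limit_nash.
- exact: lyapunov_stable_nash.
- exact: strict_nash_asymptotically_stable.
Qed.
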